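(* Let $\mathcal{S}\subset\mathbb{R}^2$ be a nonempty closed and bounded set, and let $f:\mathbb{R}\to\mathbb{R}$ and $g:\mathbb{R}^2\to\mathbb{R}$ be continuous. For $\lambda\ge 0$ consider the optimization problem $$\max_{x,y}\{f(x)+\lambda g(x,y) : (x,y)\in\mathcal{S}\}.$$ If $f$ is strictly increasing, then $\underline{x}^*(\lambda^1)\ge \overline{x}^*(\lambda^2)$ for all $0\le\lambda^1<\lambda^2$.
   Context: Superscripts on $\lambda$ are indices (two different values of $\lambda$), not powers. For $\lambda\ge 0$, $\mathcal{M}(\lambda)\subseteq\mathcal{S}$ denotes the set of all maximizers $(x,y)$ of the optimization problem, and $x^*(\lambda)=\{x : \exists y,\ (x,y)\in\mathcal{M}(\lambda)\}$ is its projection onto the $x$-component. This is a nonempty compact set, and one defines $\overline{x}^*(\lambda)=\max\{x : x\in x^*(\lambda)\}$ and $\underline{x}^*(\lambda)=\min\{x : x\in x^*(\lambda)\}$. *)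

(* Defs.v *)
From mathcomp Require Import all_boot all_order all_algebra.
From mathcomp Require Import all_classical all_reals all_analysis.

Set Implicit Arguments.
Unset Strict Implicit.
Unset Printing Implicit Defensive.

Import Order.TTheory GRing.Theory Num.Theory.
Import numFieldNormedType.Exports.

Local Open Scope classical_set_scope.
Local Open Scope ring_scope.

Definition objective (R : realType) (f : R -> R) (g : R * R -> R) (lam : R)
    (p : R * R) : R := f p.1 + lam * g p.

Definition maximizers (R : realType) (S : set (R * R)) (f : R -> R)
    (g : R * R -> R) (lam : R) : set (R * R) :=
  [set p | S p /\ forall q, S q -> objective f g lam q <= objective f g lam p].

Definition xstar (R : realType) (S : set (R * R)) (f : R -> R)
    (g : R * R -> R) (lam : R) : set R :=
  [set x | exists y, maximizers S f g lam (x, y)].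

(* The greatest and the least element of [A], with junk value [0] when there is
   none; [set_maxP] and [set_minP] show that they exist when [A] is nonempty and
   compact, and [xstar_neq0] and [xstar_compact] that [xstar] is such a set. *)
Definition set_max (R : realType) (A : set R) : R := xget 0 (A `&` ubound A).
Definition set_min (R : realType) (A : set R) : R := xget 0 (A `&` lbound A).

Definition xmax (R : realType) (S : set (R * R)) (f : R -> R)
    (g : R * R -> R) (lam : R) : R := set_max (xstar S f g lam).
Definition xmin (R : realType) (S : set (R * R)) (f : R -> R)
    (g : R * R -> R) (lam : R) : R := set_min (xstar S f g lam).

Lemma set_maxP (R : realType) (A : set R) :
  A !=set0 -> compact A -> A (set_max A) /\ ubound A (set_max A).
Proof.
move=> A0 cA; apply: (@xgetPex _ 0 (A `&` ubound A)).
have [|c cA' cmax] := @compact_EVT_max _ R id A A0 cA.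
  by apply: continuous_subspaceT => x; exact: cvg_id.
by exists c; split; [rewrite -inE | move=> x Ax; apply: cmax; rewrite inE].
Qed.

Lemma set_minP (R : realType) (A : set R) :
  A !=set0 -> compact A -> A (set_min A) /\ lbound A (set_min A).
Proof.
move=> A0 cA; apply: (@xgetPex _ 0 (A `&` lbound A)).
have [|c cA' cmin] := @compact_EVT_min _ R id A A0 cA.
  by apply: continuous_subspaceT => x; exact: cvg_id.
by exists c; split; [rewrite -inE | move=> x Ax; apply: cmin; rewrite inE].
Qed.

Lemma bounded_closed_compact2 (R : realType) (S : set (R * R)) :
  closed S -> bounded_set S -> compact S.
Proof.
move=> cS [M [_ /(_ (`|M| + 1))]] bS.
have {}bS : forall p, S p -> `|p| <= `|M| + 1.
  by apply: bS; rewrite (le_lt_trans (ler_norm M))// ltrDl.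
pose I := `[- (`|M| + 1), `|M| + 1]%classic : set R.
apply: (subclosed_compact cS (compact_setX (@segment_compact _ _ _)
  (@segment_compact _ _ _)) : _ `<=` I `*` I -> _).
move=> p /bS; rewrite prod_normE ge_max => /andP[p1 p2].
by split; rewrite /I /= in_itv /= -ler_norml.
Qed.

Lemma objective_continuous (R : realType) (f : R -> R) (g : R * R -> R)
    (lam : R) :
  continuous f -> continuous g -> continuous (objective f g lam).
Proof.
move=> cf cg p; apply: cvgD.
  by apply: (@continuous_comp _ _ _ fst f); [exact: cvg_fst | exact: cf].
by apply: cvgM; [exact: cvg_cst | exact: cg].
Qed.

Lemma xstar_neq0 (R : realType) (S : set (R * R)) (f : R -> R)
    (g : R * R -> R) (lam : R) :
  S !=set0 -> closed S -> bounded_set S -> continuous f -> continuous g ->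
  xstar S f g lam !=set0.
Proof.
move=> S0 cS bS cf cg.
have [|[x y] Sxy xymax] := compact_EVT_max S0 (bounded_closed_compact2 cS bS)
  (f := objective f g lam).
  by apply: continuous_subspaceT; exact: objective_continuous.
exists x, y; split; first by rewrite inE in Sxy.
by move=> q Sq; apply: xymax; rewrite inE.
Qed.

Lemma xstar_compact (R : realType) (S : set (R * R)) (f : R -> R)
    (g : R * R -> R) (lam : R) :
  closed S -> bounded_set S -> continuous f -> continuous g ->
  compact (xstar S f g lam).
Proof.
move=> cS bS cf cg.
have -> : xstar S f g lam = fst @` maximizers S f g lam.
  apply/seteqP; split=> [x [y Mxy]|_ [[x y] Mxy <-]]; last by exists y.
  by exists (x, y).
apply: continuous_compact.
  by apply: continuous_subspaceT => p; exact: cvg_fst.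
apply: (@subclosed_compact _ _ S _ (bounded_closed_compact2 cS bS));
  last by move=> p [].
have -> : maximizers S f g lam = S `&` \bigcap_(q in S)
    (objective f g lam @^-1` [set t | objective f g lam q <= t]).
  by apply/seteqP; split.
apply: closedI => //; apply: closed_bigI => q _.
apply: preimage_closed => [p _|]; last exact: closed_ge.
exact: objective_continuous.
Qed.

(* Main.v *)
(* Adding the optimality inequalities of a maximizer [p] at [lam1] and [q] at
   [lam2] gives [(lam2 - lam1) * (g q - g p) >= 0], so [g p <= g q]; optimality
   of [p] at [lam1 >= 0] then forces [f q.1 <= f p.1]. *)
Require Import Defs.
From mathcomp Require Import all_boot all_order all_algebra.
From mathcomp Require Import all_classical all_reals all_analysis.
From mathcomp Require Import lra.

Import Order.TTheory GRing.Theory Num.Theory.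
Import numFieldNormedType.Exports.

Local Open Scope classical_set_scope.
Local Open Scope ring_scope.

Lemma maximizers_le_g (R : realType) (S : set (R * R)) (f : R -> R)
    (g : R * R -> R) (lam1 lam2 : R) (p q : R * R) :
  lam1 < lam2 -> maximizers S f g lam1 p -> maximizers S f g lam2 q ->
  g p <= g q.
Proof.
rewrite /maximizers /objective => lam12 [Sp /(_ q) pmax] [Sq /(_ p Sp) qmax].
have {}pmax := pmax Sq.
(* After scaling by the positive [lam2 - lam1], the goal is the sum of [pmax] and [qmax], where the
   [f] terms cancel; it is linear in the products of [lam1], [lam2] with values of [g]. *)
rewrite -subr_ge0 -(@pmulr_rge0 _ (lam2 - lam1)) ?subr_gt0//; lra.
Qed.

Lemma maximizers_ge_f (R : realType) (S : set (R * R)) (f : R -> R)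
    (g : R * R -> R) (lam1 lam2 : R) (p q : R * R) :
  0 <= lam1 -> lam1 < lam2 ->
  maximizers S f g lam1 p -> maximizers S f g lam2 q -> f q.1 <= f p.1.
Proof.
move=> lam1_ge0 lam12 Mp Mq.
have gpq := ler_wpM2l lam1_ge0 (maximizers_le_g _ _ _ _ _ _ _ _ lam12 Mp Mq).
have := Mp.2 q Mq.1; rewrite /objective; lra.
Qed.

Theorem theorem1 (R : realType) (S : set (R * R)) (f : R -> R)
    (g : R * R -> R) (S_neq0 : S !=set0) (S_closed : closed S)
    (S_bounded : bounded_set S) (f_cont : continuous f) (g_cont : continuous g)
    (f_incr : {homo f : x y / x < y}) :
  forall lam1 lam2 : R, 0 <= lam1 -> lam1 < lam2 ->
    xmin S f g lam1 >= xmax S f g lam2.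
Proof.
move=> lam1 lam2 lam1_ge0 lam12.
have x_neq0 lam : xstar S f g lam !=set0 by exact: xstar_neq0.
have x_compact lam : compact (xstar S f g lam) by exact: xstar_compact.
(* Both extrema are attained, so each is the first coordinate of an actual maximizer. *)
have [[y1 M1] _] := set_minP (x_neq0 lam1) (x_compact lam1).
have [[y2 M2] _] := set_maxP (x_neq0 lam2) (x_compact lam2).
(* If the least [x] at [lam1] were below the greatest at [lam2], strict monotonicity would order
   their [f] values strictly, against [maximizers_ge_f]. *)
rewrite leNgt; apply/negP => /f_incr; apply/negP; rewrite -leNgt.
exact: (maximizers_ge_f _ _ _ _ _ _ _ _ lam1_ge0 lam12 M1 M2).
Qed.
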